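(* Let $\epsilon\in(0,1]$, $\delta\in(0,1)$, $0<\gamma\le\epsilon/14$, and $b=4/\gamma$. Then for every belief matrix $P\in[0,1]^{n\times m}$ and ground truth $\vec\theta\in[0,1]^m$ with $m\ge\frac{28\ln(2n/\delta)}{\epsilon\gamma}$, and every report matrix $R$ in which each $r_i$ is undominated for belief $p_i$, ReportNoisyMax with scale $b$ selects an $\epsilon$-optimal forecaster with probability at least $1-\delta$ (over $\vec y\sim\vec\theta$ and the noise). In particular its event complexity is $O(\ln(n/\delta)/\epsilon^2)$.
   Context: Setting: $n$ forecasters, $m$ independent binary events with $\Pr[y_t=1]=\theta_t$; forecaster $i$ has beliefs $p_i\in[0,1]^m$ and reports $r_i\in[0,1]^m$. Quadratic score $S(q,y)=1-(y-q)^2$. Accuracy $a_i=1-\frac1m\sum_t(p_{it}-\theta_t)^2$; $i$ is $\epsilon$-optimal if $a_i\ge\max_ja_j-\epsilon$. ReportNoisyMax with scale $b$: compute $q_j=\sum_tS(r_{jt},y_t)$, add independent Laplace noise with density $\frac1{2b}e^{-|w|/b}$ to each, and select the forecaster with the largest noisy total. $M(R;p_i)=\mathbb{E}_{\vec y\sim p_i}M(R,\vec y)$ with $y_t\sim\mathrm{Bernoulli}(p_{it})$ independently; for fixed $p_i$, $\hat r_i$ strictly dominates $r_i$ if $M(\hat r_i,R_{-i};p_i)_i>M(r_i,R_{-i};p_i)_i$ for all $R_{-i}$, and $r_i$ is undominated if nothing strictly dominates it. *)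

(* Defs.v *)
From HB Require Import structures.
From mathcomp Require Import all_boot all_order all_algebra.
From mathcomp Require Import all_classical all_reals.
From mathcomp Require Import ereal topology normedtype sequences exp measure
  lebesgue_measure lebesgue_integral.

Set Implicit Arguments.
Unset Strict Implicit.
Unset Printing Implicit Defensive.

Import Order.TTheory GRing.Theory Num.Theory.
Local Open Scope ring_scope.

Section Forecasting.
Variable R : realType.

Definition in01 (x : R) : Prop := 0 <= x <= 1.

Definition qscore (q : R) (y : bool) : R := 1 - ((y%:R : R) - q) ^+ 2.

Definition total_score (m : nat) (r : 'I_m -> R) (y : {ffun 'I_m -> bool}) : R :=
  \sum_(t < m) qscore (r t) (y t).

Definition outcome_prob (m : nat) (p : 'I_m -> R) (y : {ffun 'I_m -> bool}) : R :=
  \prod_(t < m) (if y t then p t else 1 - p t).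

Definition accuracy (m : nat) (theta p : 'I_m -> R) : R :=
  1 - (m%:R)^-1 * \sum_(t < m) (p t - theta t) ^+ 2.

Definition eps_optimal (n m : nat) (eps : R) (theta : 'I_m -> R)
    (P : 'I_n -> 'I_m -> R) (i : 'I_n) : bool :=
  [forall j, accuracy theta (P j) - eps <= accuracy theta (P i)].

Definition laplace_pdf (b w : R) : R := (2 * b)^-1 * expR (- (`|w| / b)).

(* i is the selected index: a maximiser of v (ties, which have probability
   zero, broken towards the smallest index) *)
Definition selected (n : nat) (v : 'I_n -> R) (i : 'I_n) : bool :=
  [forall k, v k <= v i] && [forall k : 'I_n, (k < i)%N ==> (v k < v i)].

Definition upd_noise (n : nat) (w : 'I_n -> R) (j : 'I_n) (x : R) : 'I_n -> R :=
  fun k => if k == j then x else w k.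

(* Iterated integration of g against the independent Laplace(b) densities of
   the coordinates listed in s (this is the integral against the product
   (joint) density of independent Laplace noises). *)
Fixpoint noise_int (n : nat) (b : R) (s : seq 'I_n)
    (g : ('I_n -> R) -> \bar R) (w : 'I_n -> R) {struct s} : \bar R :=
  match s with
  | [::] => g w
  | j :: s' => (\int[@lebesgue_measure R]_x
                  ((laplace_pdf b x)%:E * noise_int b s' g (upd_noise w j x)))%E
  end.

Definition noise_prob (n : nat) (b : R) (E : ('I_n -> R) -> bool) : \bar R :=
  noise_int b (enum 'I_n) (fun w => ((E w)%:R : R)%:E) (fun _ => 0).

Definition rnm_prob (n m : nat) (b : R) (Rep : 'I_n -> 'I_m -> R)
    (y : {ffun 'I_m -> bool}) (A : pred 'I_n) : \bar R :=
  noise_prob b (fun w =>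
    [exists i, (i \in A) && selected (fun j => total_score (Rep j) y + w j) i]).

Definition M_sel (n m : nat) (b : R) (Rep : 'I_n -> 'I_m -> R)
    (y : {ffun 'I_m -> bool}) (i : 'I_n) : \bar R :=
  rnm_prob b Rep y (pred1 i).

Definition M_exp (n m : nat) (b : R) (Rep : 'I_n -> 'I_m -> R)
    (p : 'I_m -> R) (i : 'I_n) : \bar R :=
  (\sum_(y : {ffun 'I_m -> bool}) (outcome_prob p y)%:E * M_sel b Rep y i)%E.

Definition upd_row (n m : nat) (Rep : 'I_n -> 'I_m -> R) (i : 'I_n)
    (r : 'I_m -> R) : 'I_n -> 'I_m -> R :=
  fun j => if j == i then r else Rep j.

Definition strictly_dominates (n m : nat) (b : R) (i : 'I_n) (p : 'I_m -> R)
    (rhat r : 'I_m -> R) : Prop :=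
  forall Rep : 'I_n -> 'I_m -> R, (forall j t, in01 (Rep j t)) ->
    (M_exp b (upd_row Rep i r) p i < M_exp b (upd_row Rep i rhat) p i)%E.

Definition undominated (n m : nat) (b : R) (i : 'I_n) (p : 'I_m -> R)
    (r : 'I_m -> R) : Prop :=
  ~ exists rhat : 'I_m -> R, (forall t, in01 (rhat t)) /\
      strictly_dominates b i p rhat r.

End Forecasting.

(* Main.v *)
Require Import Defs.
From HB Require Import structures.
From mathcomp Require Import all_boot all_order all_algebra.
From mathcomp Require Import all_classical all_reals.
From mathcomp Require Import ereal topology normedtype sequences exp measure
  lebesgue_measure lebesgue_integral.
From mathcomp Require Import measurable_realfun ftc exponential_distribution.
From mathcomp Require Import ring lra.
Import Order.TTheory GRing.Theory Num.Theory.
Import numFieldNormedType.Exports.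
Set Implicit Arguments.
Unset Strict Implicit.
Unset Printing Implicit Defensive.
Local Open Scope classical_set_scope.
Local Open Scope ring_scope.

(* Undominated reports are within [gamma] of the beliefs. Conditionally on the
   noise of the other forecasters and on the outcomes of the other rounds, the
   chance of being selected is a tail of the Laplace law, whose density varies
   by a factor at most [expR gamma] over the range of scores at stake; so if
   [|r t - p t| > gamma], moving [r t] to [p t] raises this conditional chance
   for every value of the noise, hence the selection probability.

   If [j] is not [eps]-optimal, some [k] beats it by [eps] in accuracy, so the
   mean total score of [k] exceeds that of [j] by at least
   [m * (eps - 4 * gamma)]. Selecting [j] forces
   [1 <= expR (lam * (score j + w j - score k - w k))]; for [lam = 1 / (2 * b)]
   the noise contributes a factor at most 4 and the scores are handled by their
   moment generating function. The probability of selecting [j] is then at most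
   [(delta / n) ^+ 2], and a union bound over [j] concludes. *)

(** * Laplace noise *)

Section Laplace.
Variables (R : realType) (b : R).
Hypothesis b_gt0 : 0 < b.
Let mu := @lebesgue_measure R.

Lemma laplace_pdf_gt0 x : 0 < laplace_pdf b x.
Proof. by rewrite /laplace_pdf mulr_gt0 ?expR_gt0// invr_gt0 mulr_gt0. Qed.

Lemma laplace_pdf_ge0 x : 0 <= laplace_pdf b x.
Proof. exact/ltW/laplace_pdf_gt0. Qed.

Lemma continuous_laplace_pdf : continuous (laplace_pdf b).
Proof.
move=> x; rewrite /laplace_pdf.
apply: cvgM; first exact: cvg_cst.
apply: continuous_comp; last exact: continuous_expR.
apply: cvgN; apply: cvgM; last exact: cvg_cst.
exact: norm_continuous.
Qed.

Lemma measurable_laplace_pdf : measurable_fun setT (laplace_pdf b).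
Proof. exact: continuous_measurable_fun continuous_laplace_pdf. Qed.

(** The density is even, and on the half-line it is half the exponential density of rate [b^-1],
    which integrates to 1. *)
Lemma integral_laplace_pdf : (\int[mu]_x (laplace_pdf b x)%:E = 1)%E.
Proof.
rewrite ge0_symfun_integralT; last 3 first.
- exact: laplace_pdf_ge0.
- exact: continuous_laplace_pdf.
- by move=> x; rewrite /= /laplace_pdf normrN.
have binv : 0 < b^-1 by rewrite invr_gt0.
have <- := integral_exponential_pdf binv.
have -> : (\int[mu]_(x in [set x | (0 <= x)%R]) (laplace_pdf b x)%:E =
    \int[mu]_(x in [set x | (0 <= x)%R]) ((2^-1)%:E * (exponential_pdf b^-1 x)%:E))%E.
  apply: eq_integral => x; rewrite inE/= => x0; rewrite exponential_pdfE//.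
  rewrite /laplace_pdf ger0_norm// -EFinM; congr EFin.
  by rewrite invfM mulrA; congr (_ * expR _); rewrite mulNr mulrC.
rewrite -set_itvcy ge0_integralZl_EFin//; last 2 first.
- by move=> x _; rewrite lee_fin; exact: exponential_pdf_ge0 (ltW binv) _.
- apply/measurable_EFinP; apply: measurable_funTS; exact: measurable_exponential_pdf.
rewrite muleA -EFinM divff// mul1e.
rewrite [LHS]integral_mkcond; apply: eq_integral => x _.
rewrite patchE; case: ifPn => //; rewrite notin_setE/= in_itv/= andbT => /negP.
by rewrite -ltNge => x0; rewrite lt0_exponential_pdf.
Qed.

(** By the triangle inequality the log-density is [1/b]-Lipschitz; this is the bounded ratio of
    densities behind the gain from truthfulness. *)
Lemma laplace_pdf_lipschitz x z :
  laplace_pdf b x <= expR (`|x - z| / b) * laplace_pdf b z.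
Proof.
rewrite /laplace_pdf mulrCA ler_pM2l ?invr_gt0 ?mulr_gt0// -expRD ler_expR.
rewrite -mulNr -mulNr -mulrDl ler_pM2r ?invr_gt0//.
have := ler_distD x z 0; rewrite !subr0 distrC; lra.
Qed.

End Laplace.

(** * Iterated integrals against independent Laplace noises *)

Section NoiseIntegral.
Variables (R : realType) (n : nat) (b : R).
Hypothesis b_gt0 : 0 < b.
Let mu := @lebesgue_measure R.
Local Open Scope ereal_scope.
Implicit Types (g h : ('I_n -> R) -> \bar R) (w : 'I_n -> R) (s : seq 'I_n).

(* Joint measurability on R^n, expressed through the universal property of the
   product sigma-algebra since 'I_n -> R carries no measurable structure. *)
Definition coord_measurable g := forall d (T : measurableType d)
  (W : T -> 'I_n -> R), (forall k, measurable_fun setT (fun t => W t k)) ->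
  measurable_fun setT (fun t => g (W t)).

Lemma measurable_upd_noise d (T : measurableType d) (W : T -> 'I_n -> R)
    (X : T -> R) j k :
  (forall i, measurable_fun setT (fun t => W t i)) -> measurable_fun setT X ->
  measurable_fun setT (fun t => upd_noise (W t) j (X t) k).
Proof. by move=> mW mX; rewrite /upd_noise; case: (k == j). Qed.

Lemma coord_measurable_upd g w j : coord_measurable g ->
  measurable_fun setT (fun x => g (upd_noise w j x)).
Proof.
move=> mg; apply: mg => k; exact: (measurable_upd_noise (W := fun _ => w)).
Qed.

Lemma noise_int_ge0 s g w : (forall v, 0 <= g v) -> 0 <= noise_int b s g w.
Proof.
move=> g0; elim: s w => //= j s ih w; apply: integral_ge0 => x _.
by rewrite mule_ge0// lee_fin laplace_pdf_ge0.
Qed.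

(** Induction on [s]: the hypothesis, applied over the product space [T * R], makes the integrand
    jointly measurable, and Tonelli makes its partial integral measurable. This is where quantifying
    over every [T] in [coord_measurable] pays off. *)
Lemma coord_measurable_noise_int s g : (forall v, 0 <= g v) ->
  coord_measurable g -> coord_measurable (noise_int b s g).
Proof.
move=> g0 mg; elim: s => //= j s ih d T W mW.
pose f (z : T * R) := (laplace_pdf b z.2)%:E *
  noise_int b s g (upd_noise (W z.1) j z.2).
apply: (measurable_fun_fubini_tonelli_F (m2 := mu) f).
- apply: emeasurable_funM.
    apply/measurable_EFinP; apply: measurableT_comp => //.
    exact: measurable_laplace_pdf.
  apply: (ih _ _ (fun z : T * R => upd_noise (W z.1) j z.2)) => k.
  apply: (measurable_upd_noise (W := fun z : T * R => W z.1)) => // i.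
  by apply: (measurableT_comp (mW i)).
- move=> z; rewrite /f mule_ge0//; first by rewrite lee_fin laplace_pdf_ge0.
  exact: noise_int_ge0.
Qed.

Lemma measurable_noise_integrand s g w j : (forall v, 0 <= g v) ->
  coord_measurable g ->
  measurable_fun setT
    (fun x => (laplace_pdf b x)%:E * noise_int b s g (upd_noise w j x)).
Proof.
move=> g0 mg; apply: emeasurable_funM.
  by apply/measurable_EFinP; exact: measurable_laplace_pdf.
by apply: coord_measurable_upd; exact: coord_measurable_noise_int.
Qed.

Lemma noise_integrand_ge0 s g w j x : (forall v, 0 <= g v) ->
  0 <= (laplace_pdf b x)%:E * noise_int b s g (upd_noise w j x).
Proof.
by move=> g0; rewrite mule_ge0// ?lee_fin ?laplace_pdf_ge0// noise_int_ge0.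
Qed.

Lemma le_noise_int s g h w : (forall v, 0 <= g v) ->
  coord_measurable g -> coord_measurable h -> (forall v, g v <= h v) ->
  noise_int b s g w <= noise_int b s h w.
Proof.
move=> g0 mg mh gh; have h0 v : 0 <= h v by exact: le_trans (gh v).
elim: s w => [|j s ih] w /=; first exact: gh.
apply: ge0_le_integral => //.
- by move=> x _; exact: noise_integrand_ge0.
- exact: measurable_noise_integrand.
- exact: measurable_noise_integrand.
- by move=> x _; rewrite lee_pmul2l// lte_fin laplace_pdf_gt0.
Qed.

Lemma noise_int_cst s c w : 0 <= c -> noise_int b s (fun _ => c) w = c.
Proof.
move=> c0; elim: s w => //= j s ih w.
under eq_integral do rewrite ih muleC.
rewrite ge0_integralZl//; last 2 first.
- by apply/measurable_EFinP; exact: measurable_laplace_pdf.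
- by move=> x _; rewrite lee_fin laplace_pdf_ge0.
by rewrite integral_laplace_pdf// mule1.
Qed.

Lemma eq_noise_int s g h w : g =1 h -> noise_int b s g w = noise_int b s h w.
Proof. by move=> /funext ->. Qed.

Lemma coord_measurable_add g h : coord_measurable g -> coord_measurable h ->
  coord_measurable (fun v => g v + h v).
Proof.
by move=> mg mh d T W mW; apply: emeasurable_funD; [exact: mg|exact: mh].
Qed.

Lemma coord_measurable_scale c g : coord_measurable g ->
  coord_measurable (fun v => c * g v).
Proof. by move=> mg d T W mW; apply: measurable_funeM; exact: mg. Qed.

Lemma coord_measurable_sum (I : Type) (r : seq I) (P : pred I)
    (g : I -> ('I_n -> R) -> \bar R) :
  (forall i, coord_measurable (g i)) ->
  coord_measurable (fun v => \sum_(i <- r | P i) g i v).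
Proof.
move=> mg d T W mW.
under eq_fun do rewrite big_mkcond/=.
apply: emeasurable_sum => i; case: (P i); last exact: measurable_cst.
exact: mg.
Qed.

Lemma noise_int_add s g h w : (forall v, 0 <= g v) -> (forall v, 0 <= h v) ->
  coord_measurable g -> coord_measurable h ->
  noise_int b s (fun v => g v + h v) w = noise_int b s g w + noise_int b s h w.
Proof.
move=> g0 h0 mg mh; elim: s w => //= j s ih w.
under eq_integral.
  move=> x _; rewrite ih muleDr//; first over.
  by rewrite ge0_adde_def// inE; exact: noise_int_ge0.
rewrite ge0_integralD//.
- by move=> x _; exact: noise_integrand_ge0.
- exact: measurable_noise_integrand.
- by move=> x _; exact: noise_integrand_ge0.
- exact: measurable_noise_integrand.
Qed.

Lemma noise_int_scale s c g w : 0 <= c -> (forall v, 0 <= g v) ->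
  coord_measurable g ->
  noise_int b s (fun v => c * g v) w = c * noise_int b s g w.
Proof.
move=> c0 g0 mg; elim: s w => //= j s ih w.
under eq_integral do rewrite ih muleCA.
rewrite ge0_integralZl//.
- exact: measurable_noise_integrand.
- by move=> x _; exact: noise_integrand_ge0.
Qed.

Lemma noise_int_sum s (I : Type) (r : seq I) (P : pred I)
    (g : I -> ('I_n -> R) -> \bar R) w :
  (forall i v, 0 <= g i v) -> (forall i, coord_measurable (g i)) ->
  noise_int b s (fun v => \sum_(i <- r | P i) g i v) w =
  \sum_(i <- r | P i) noise_int b s (g i) w.
Proof.
move=> g0 mg; elim: r => [|i r ih].
  under eq_noise_int do rewrite big_nil.
  by rewrite big_nil noise_int_cst.
under eq_noise_int do rewrite big_cons.
rewrite big_cons; case: (P i) => //.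
rewrite noise_int_add// ?ih//; first by move=> v; exact: sume_ge0.
exact: coord_measurable_sum.
Qed.

Lemma noise_int_cat s1 s2 g w :
  noise_int b (s1 ++ s2) g w = noise_int b s1 (noise_int b s2 g) w.
Proof.
by elim: s1 w => //= j s1 ih w; apply: eq_integral => x _; rewrite ih.
Qed.

Lemma upd_noiseC w i j x y : i != j ->
  upd_noise (upd_noise w i x) j y = upd_noise (upd_noise w j y) i x.
Proof.
move=> ij; apply/funext => k; rewrite /upd_noise.
by case: (eqVneq k j) => // ->; rewrite eq_sym (negbTE ij).
Qed.

(** Tonelli on the plane; [i != j] makes the two noise updates commute. *)
Lemma noise_int_swap i j g w : i != j -> (forall v, 0 <= g v) ->
  coord_measurable g ->
  noise_int b [:: i; j] g w = noise_int b [:: j; i] g w.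
Proof.
move=> ij g0 mg /=.
pose f (z : R * R) := (laplace_pdf b z.1)%:E * ((laplace_pdf b z.2)%:E *
  g (upd_noise (upd_noise w i z.1) j z.2)).
have mpdf := measurable_laplace_pdf b.
have mf : measurable_fun setT f.
  apply: emeasurable_funM; first by apply/measurable_EFinP; apply: measurableT_comp.
  apply: emeasurable_funM; first by apply/measurable_EFinP; apply: measurableT_comp.
  apply: (mg _ _ (fun z : R * R => upd_noise (upd_noise w i z.1) j z.2)) => k.
  apply: (measurable_upd_noise (W := fun z : R * R => upd_noise w i z.1)) => // k'.
  exact: (measurable_upd_noise (W := fun z : R * R => w)).
have f0 z : 0 <= f z by rewrite /f !mule_ge0// lee_fin laplace_pdf_ge0.
have mpdfE : measurable_fun setT (fun x => (laplace_pdf b x)%:E).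
  exact/measurable_EFinP.
transitivity (\int[mu]_x \int[mu]_y f (x, y)).
  apply: eq_integral => x _; rewrite -ge0_integralZl// ?lee_fin ?laplace_pdf_ge0//.
    apply: emeasurable_funM => //; exact: coord_measurable_upd.
  by move=> y _; rewrite mule_ge0// lee_fin laplace_pdf_ge0.
transitivity (\int[mu]_y \int[mu]_x f (x, y)).
  exact: (fubini_tonelli (m1 := mu) (m2 := mu) f mf f0).
apply: eq_integral => y _.
transitivity (\int[mu]_x ((laplace_pdf b y)%:E * ((laplace_pdf b x)%:E *
    g (upd_noise (upd_noise w j y) i x)))).
  by apply: eq_integral => x _; rewrite /f/= muleCA upd_noiseC.
rewrite ge0_integralZl// ?lee_fin ?laplace_pdf_ge0//.
- apply: emeasurable_funM => //; exact: coord_measurable_upd.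
- by move=> x _; rewrite mule_ge0// lee_fin laplace_pdf_ge0.
Qed.

(** Successive adjacent swaps carry [i] past every index of [s], so that its noise is integrated
    innermost. *)
Lemma noise_int_rot1 i s g w : i \notin s -> (forall v, 0 <= g v) ->
  coord_measurable g ->
  noise_int b (i :: s) g w = noise_int b (rcons s i) g w.
Proof.
move=> + g0 mg; elim: s w => // j s ih w; rewrite inE negb_or => /andP[ij si].
have h0 v : 0 <= noise_int b s g v by exact: noise_int_ge0.
have := @noise_int_swap i j (noise_int b s g) w ij h0
  (coord_measurable_noise_int s g0 mg).
rewrite -!noise_int_cat/= => ->.
by apply: eq_integral => x _; rewrite -ih.
Qed.

(** If the integrals agreed, the positive function [h - f] would have integral 0 and so vanish
    almost everywhere, making the whole line a null set. *)
Lemma lt_integral (f h : R -> \bar R) :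
  measurable_fun setT f -> measurable_fun setT h ->
  (forall x, 0 <= f x) -> (forall x, f x < h x) -> \int[mu]_x h x < +oo ->
  \int[mu]_x f x < \int[mu]_x h x.
Proof.
move=> mf mh f0 fh hfin.
have h0 x : 0 <= h x by apply: le_trans (ltW (fh x)).
have ffin x : f x \is a fin_num.
  by rewrite ge0_fin_numE// (lt_le_trans (fh x))// leey.
pose d x := h x - f x.
have d0 x : 0 <= d x by rewrite /d sube_ge0 ?ffin// ltW.
have md : measurable_fun setT d by apply: emeasurable_funB.
have fdh : \int[mu]_x h x = \int[mu]_x f x + \int[mu]_x d x.
  rewrite -ge0_integralD//; apply: eq_integral => x _.
  by rewrite /d addeC subeK.
have fle : \int[mu]_x f x <= \int[mu]_x h x.
  by rewrite fdh leeDl// integral_ge0.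
have fif : \int[mu]_x f x \is a fin_num.
  by rewrite ge0_fin_numE ?integral_ge0// (le_lt_trans fle).
rewrite fdh lteDl// lt0e integral_ge0// andbT.
apply/eqP => dint0.
have : ae_eq mu setT d (cst 0).
  apply/(ae_eq_integral_abs mu measurableT md); rewrite -dint0.
  by apply: eq_integral => x _; rewrite gee0_abs.
case=> N [mN N0 subN].
have NT : N = setT.
  apply/seteqP; split => // x _; apply: subN => /= /(_ Logic.I) /eqP.
  by rewrite gt_eqF// /d sube_gt0.

have : mu setT = 0 by rewrite -NT.
have := @lebesgue_measure_itv R `]-oo, +oo[%R.
by rewrite set_itvE /= /mu => + muT0; rewrite muT0.
Qed.

(** Strictness passes through each integral by [lt_integral]; the bound [h v <= 1] keeps all of them
    finite. *)
Lemma lt_noise_int s g h w : (forall v, 0 <= g v) -> coord_measurable g ->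
  coord_measurable h -> (forall v, g v < h v) -> (forall v, h v <= 1) ->
  noise_int b s g w < noise_int b s h w.
Proof.
move=> g0 mg mh gh h1; have h0 v : 0 <= h v by exact: le_trans (ltW (gh v)).
have hs1 s' v : noise_int b s' h v <= 1.
  rewrite -[leRHS](@noise_int_cst s' 1 v)//; apply: le_noise_int => //.
elim: s w => [|j s ih] w /=; first exact: gh.
apply: lt_integral.
- exact: measurable_noise_integrand.
- exact: measurable_noise_integrand.
- by move=> x; exact: noise_integrand_ge0.
- move=> x; rewrite lte_pmul2l ?lte_fin ?laplace_pdf_gt0//.
- by have := hs1 (j :: s) w => /= /le_lt_trans; apply; rewrite ltey.
Qed.

End NoiseIntegral.

(** * Tails of the Laplace law and the gain from truthfulness *)

Section LaplaceTail.
Variables (R : realType) (b : R).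
Hypothesis b_gt0 : 0 < b.
Let mu := @lebesgue_measure R.

Definition laplace_tail (c : R) : R :=
  fine (\int[mu]_(x in `[c, +oo[) (laplace_pdf b x)%:E)%E.

Let mpdf (D : set R) : measurable_fun D (fun x => (laplace_pdf b x)%:E).
Proof. by apply/measurable_EFinP; apply: measurable_funTS; exact: measurable_laplace_pdf. Qed.

Let pdf0 (x : R) : (0 <= (laplace_pdf b x)%:E)%E.
Proof. by rewrite lee_fin laplace_pdf_ge0. Qed.

Lemma integral_laplace_pdf_le1 (D : set R) : measurable D ->
  (\int[mu]_(x in D) (laplace_pdf b x)%:E <= 1)%E.
Proof.
move=> mD; rewrite -(integral_laplace_pdf b_gt0).
by apply: ge0_subset_integral => //; exact: mpdf.
Qed.

Lemma laplace_tailE c :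
  (laplace_tail c)%:E = (\int[mu]_(x in `[c, +oo[) (laplace_pdf b x)%:E)%E.
Proof.
rewrite /laplace_tail fineK// ge0_fin_numE; last exact: integral_ge0.
by apply: (le_lt_trans (integral_laplace_pdf_le1 _)); rewrite ?ltry.
Qed.

Lemma laplace_tail_ge0 c : 0 <= laplace_tail c.
Proof. by rewrite -lee_fin laplace_tailE integral_ge0. Qed.

Lemma laplace_tail_le1 c : laplace_tail c <= 1.
Proof. by rewrite -lee_fin laplace_tailE integral_laplace_pdf_le1. Qed.

Lemma laplace_tailB a c : a <= c ->
  (laplace_tail a - laplace_tail c)%:E =
  (\int[mu]_(x in `[a, c[) (laplace_pdf b x)%:E)%E.
Proof.
move=> ac; rewrite EFinB !laplace_tailE.
have -> : `[a, +oo[%classic = `[a, c[ `|` `[c, +oo[.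
  by rewrite -itv_bndbnd_setU.
rewrite ge0_integral_setU//.
- by rewrite addeK// -laplace_tailE.
- exact: mpdf.
- apply/disj_setPS => x /= [].
  by rewrite !in_itv/= => /andP[_ xc]; rewrite andbT leNgt xc.
Qed.

Lemma laplace_tailB_ge a c k : a <= c -> 0 <= k ->
  (forall x, a <= x <= c -> k <= laplace_pdf b x) ->
  k * (c - a) <= laplace_tail a - laplace_tail c.
Proof.
move=> ac k0 kle; rewrite -lee_fin laplace_tailB//.
have -> : (k * (c - a))%:E = (\int[mu]_(x in `[a, c[) cst k%:E x)%E.
  rewrite integral_cst//= lebesgue_measure_itv/= lte_fin.
  move: ac; rewrite le_eqVlt => /predU1P[->|->]; last by rewrite EFinM.
  by rewrite ltxx subrr mulr0 mule0.
apply: ge0_le_integral => // [|x /=]; first exact: mpdf.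
 rewrite in_itv/= => /andP[ax xc].
by rewrite lee_fin kle// ax ltW.
Qed.

Lemma laplace_tailB_le a c k : a <= c -> 0 <= k ->
  (forall x, a <= x <= c -> laplace_pdf b x <= k) ->
  laplace_tail a - laplace_tail c <= k * (c - a).
Proof.
move=> ac k0 kle; rewrite -lee_fin laplace_tailB//.
have -> : (k * (c - a))%:E = (\int[mu]_(x in `[a, c[) cst k%:E x)%E.
  rewrite integral_cst//= lebesgue_measure_itv/= lte_fin.
  move: ac; rewrite le_eqVlt => /predU1P[->|->]; last by rewrite EFinM.
  by rewrite ltxx subrr mulr0 mule0.
apply: ge0_le_integral => // [|x /=]; first exact: mpdf.
 rewrite in_itv/= => /andP[ax xc].
by rewrite lee_fin kle// ax ltW.
Qed.

(** The value of [E] at [c] is left open because a point is null; a tie at the threshold may thus be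
    broken either way. *)
Lemma integral_laplace_tail (E : R -> bool) c :
  measurable_fun setT E ->
  (forall x, c < x -> E x) -> (forall x, E x -> c <= x) ->
  (\int[mu]_x ((laplace_pdf b x)%:E * ((E x)%:R : R)%:E) = (laplace_tail c)%:E)%E.
Proof.
move=> mE ltE Ele; rewrite laplace_tailE.
have -> : (\int[mu]_x ((laplace_pdf b x)%:E * ((E x)%:R : R)%:E) =
           \int[mu]_(x in [set x | E x]) (laplace_pdf b x)%:E)%E.
  rewrite [RHS]integral_mkcond; apply: eq_integral => x _.
  rewrite patchE; case: ifPn; rewrite ?inE ?notin_setE/=.
    by move=> ->; rewrite mule1.
  by move=> /negP/negbTE ->; rewrite mule0.
have mE' : measurable [set x | E x].
  have := mE measurableT [set true] I.
  by rewrite setTI.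
apply/eqP; rewrite eq_le; apply/andP; split.
  apply: ge0_subset_integral => // [|x /= /Ele]; first exact: mpdf.
  by rewrite in_itv/= andbT.
rewrite -integral_itv_obnd_cbnd; last exact: mpdf.
apply: ge0_subset_integral => // [|x /=]; first exact: mpdf.
by rewrite in_itv/= andbT; exact: ltE.
Qed.

End LaplaceTail.

(** The inverse of [1 - x <= expR (- x)]. *)
Lemma expR_le_invB (R : realType) (x : R) : x < 1 -> expR x <= (1 - x)^-1.
Proof.
move=> x1; rewrite -[expR x]invrK lef_pV2 ?posrE ?invr_gt0 ?expR_gt0 ?subr_gt0//.
by rewrite -expRN; exact: expR_ge1Dx.
Qed.

(** * Gain from a truthful report in a single round *)

Section TruthfulGain.
Variables (R : realType) (gamma : R).
Hypothesis gamma_gt0 : 0 < gamma.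
Hypothesis gamma_le : gamma <= 1 / 14.
Let b := 4 / gamma.
Let T := laplace_tail b.

(* [c1] and [c0] stand for the best competing noisy total, relative to the
   forecaster's score in the other rounds, when the event does resp. does not
   occur. *)
Definition win_payoff (p c1 c0 q : R) : R :=
  p * T (c1 - qscore q true) + (1 - p) * T (c0 - qscore q false).

(** Moving the report up from [r] to [p] gains about [p * (p - r) * (2 - r - p)] times a density
    when the event occurs, and loses about [(1 - p) * (p - r) * (r + p)] times a density otherwise.
    Since [p * (2 - r - p)] exceeds [(1 - p) * (r + p)] by exactly [p - r > gamma], the gain
    survives a ratio of densities up to [expR gamma]. *)
Lemma win_payoff_lt_lo (p r c1 c0 : R) : 0 <= r -> p <= 1 -> gamma < p - r ->
  `|c1 - c0| <= 1 -> win_payoff p c1 c0 r < win_payoff p c1 c0 p.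
Proof.
move=> r0 p1 gpr c10.
have b0 : 0 < b by rewrite divr_gt0.
(* All thresholds involved lie within 2 of [c0]: 1 for the score and 1 for [c1 - c0]. Hence every
   density is [G] up to a factor [K]. *)
pose K := expR (2 / b); pose G := laplace_pdf b c0.
have K0 : 0 < K by exact: expR_gt0.
have G0 : 0 < G by exact: laplace_pdf_gt0.
have near (x z : R) : `|x - z| <= 2 ->
    laplace_pdf b x <= K * laplace_pdf b z.
  move=> xz; apply: le_trans (laplace_pdf_lipschitz b0 x z) _.
  by rewrite ler_pM2r ?laplace_pdf_gt0// ler_expR ler_pM2r// invr_gt0.
have S1 q : qscore q true = 1 - (1 - q) ^+ 2 :> R by [].
have S0 q : qscore q false = 1 - q ^+ 2 :> R by rewrite /qscore/= sub0r sqrrN.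
move: c10; rewrite ler_norml => /andP[c10l c10u].
have g0 : 0 < gamma by []; have g14 : gamma <= 1 / 14 by [].
have pr0 : 0 < p - r by apply: lt_trans gpr.
have p0 : 0 < p by lra.
have r1 : r <= 1 by lra.
have sq_le (x y : R) : 0 <= x -> x <= y -> x ^+ 2 <= y ^+ 2.
  by move=> x0 xy; rewrite lerXn2r// nnegrE// (le_trans x0).
have r20 := sqr_ge0 r; have p20 := sqr_ge0 p.
have rp2 : r ^+ 2 <= p ^+ 2 by apply: sq_le; lra.
have p21 : p ^+ 2 <= 1 by rewrite -[leRHS](expr1n _ 2); apply: sq_le; lra.
have r'20 := sqr_ge0 (1 - r); have p'20 := sqr_ge0 (1 - p).
have pr2 : (1 - p) ^+ 2 <= (1 - r) ^+ 2 by apply: sq_le; lra.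
have r21 : (1 - r) ^+ 2 <= 1.
  by rewrite -[leRHS](expr1n _ 2); apply: sq_le; lra.
have up : T (c0 - qscore r false) - T (c0 - qscore p false) <=
    (K * G) * ((c0 - qscore p false) - (c0 - qscore r false)).
  apply: laplace_tailB_le => //.
  - rewrite !S0; lra.
  - by rewrite mulr_ge0// ltW.
  - move=> x /andP[xl xu]; apply: near; rewrite ler_norml.
    move: xl xu; rewrite !S0 => xl xu; apply/andP; split; lra.
have lo : (K^-1 * G) * ((c1 - qscore r true) - (c1 - qscore p true)) <=
    T (c1 - qscore p true) - T (c1 - qscore r true).
  apply: laplace_tailB_ge => //.
  - rewrite !S1; lra.
  - by rewrite mulr_ge0 ?invr_ge0// ltW.
  - move=> x /andP[xl xu]; rewrite mulrC ler_pdivrMr// mulrC; apply: near.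
    rewrite ler_norml.
    move: xl xu; rewrite !S1 => xl xu; apply/andP; split; lra.
(* The scale [b = 4 / gamma] is what makes [K * K = expR (4 / b)] equal to [expR gamma]. *)
have KK : K * K <= (1 - gamma)^-1.
  rewrite -expRD; have -> : 2 / b + 2 / b = gamma.
    by rewrite /b; field; rewrite gt_eqF.
  by apply: expR_le_invB; lra.
rewrite /win_payoff -subr_gt0.
set d1 := T (c1 - qscore p true) - _ in lo.
set d0 := T (c0 - qscore r false) - _ in up.
have -> : p * T (c1 - qscore p true) + (1 - p) * T (c0 - qscore p false) -
   (p * T (c1 - qscore r true) + (1 - p) * T (c0 - qscore r false)) =
   p * d1 - (1 - p) * d0 by rewrite /d1 /d0; ring.
have key : (1 - p) * (r + p) * (K * K) < p * (2 - r - p).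
  apply: (@le_lt_trans _ _ ((1 - p) * (r + p) * (1 - gamma)^-1)).
    by rewrite ler_wpM2l// mulr_ge0; lra.
  rewrite ltr_pdivrMr; last lra.
  have h1 : 0 <= (1 - p) * (p - r) by apply: mulr_ge0; lra.
  have h2 := sqr_ge0 (2 * p - 1).
  (* Since [r <= p], the product is at most [2 * p * (1 - p)], hence at most 1/2. *)
  have : (1 - p) * (r + p) <= 1 / 2 by lra.
  set A := (1 - p) * (r + p); have -> : p * (2 - r - p) = A + (p - r) by rewrite /A; ring.
  move=> A12; have h3 : gamma * A <= gamma * (1 / 2) by rewrite ler_pM2l.
  have h4 : gamma * (1 - gamma) < (p - r) * (1 - gamma) by rewrite ltr_pM2r; lra.
  have h5 : gamma * gamma <= gamma * (1 / 14) by rewrite ler_pM2l.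
  lra.
have d1l : p * ((K^-1 * G) * ((p - r) * (2 - r - p))) <= p * d1.
  rewrite ler_pM2l//; apply: le_trans lo.
  by rewrite le_eqVlt; apply/orP; left; apply/eqP; rewrite !S1; ring.
have d0u : (1 - p) * d0 <= (1 - p) * ((K * G) * ((p - r) * (r + p))).
  apply: ler_wpM2l; first lra.
  apply: le_trans up _.
  by rewrite le_eqVlt; apply/orP; left; apply/eqP; rewrite !S0; ring.
rewrite subr_gt0; apply: (le_lt_trans d0u); apply: lt_le_trans d1l.
rewrite -(ltr_pM2l K0).
have -> : K * (p * (K^-1 * G * ((p - r) * (2 - r - p)))) =
  (G * (p - r)) * (p * (2 - r - p)) by field; rewrite gt_eqF.
have -> : K * ((1 - p) * (K * G * ((p - r) * (r + p)))) =
  (G * (p - r)) * ((1 - p) * (r + p) * (K * K)) by ring.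
by rewrite ltr_pM2l// mulr_gt0.
Qed.

(** The quadratic score is unchanged when the event is replaced by its complement and [q] by
    [1 - q]; this reduces over-reporting to under-reporting. *)
Lemma win_payoff_flip (p c1 c0 q : R) :
  win_payoff p c1 c0 q = win_payoff (1 - p) c0 c1 (1 - q).
Proof.
rewrite /win_payoff.
have -> : qscore (1 - q) true = qscore q false :> R by rewrite /qscore/=; ring.
have -> : qscore (1 - q) false = qscore q true :> R by rewrite /qscore/=; ring.
have -> : 1 - (1 - p) = p by ring.
by rewrite addrC.
Qed.

Lemma win_payoff_lt (p r c1 c0 : R) : in01 p -> in01 r -> gamma < `|r - p| ->
  `|c1 - c0| <= 1 -> win_payoff p c1 c0 r < win_payoff p c1 c0 p.
Proof.
move=> /andP[p0 p1] /andP[r0 r1] + c10; rewrite lter_normr => /orP[h|h].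
  rewrite (win_payoff_flip _ _ _ r) (win_payoff_flip _ _ _ p).
  by apply: win_payoff_lt_lo; rewrite 1?distrC//; lra.
by apply: win_payoff_lt_lo => //; lra.
Qed.

End TruthfulGain.

(** * Outcomes and selection *)

Section Outcomes.
Variables (R : realType) (m : nat).
Implicit Types (p q : 'I_m -> R) (y : {ffun 'I_m -> bool}) (t : 'I_m).

(** Distributivity of product over sum; it expresses the independence of the rounds. *)
Lemma sum_prod_outcomes (F : 'I_m -> bool -> R) :
  \sum_(y : {ffun 'I_m -> bool}) \prod_(t < m) F t (y t) =
  \prod_(t < m) (F t true + F t false).
Proof.
rewrite -[LHS](bigA_distr_bigA F); apply: eq_bigr => t _.
by rewrite big_bool.
Qed.

Lemma outcome_prob_ge0 p y : (forall t, in01 (p t)) -> 0 <= outcome_prob p y.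
Proof.
move=> p01; apply: prodr_ge0 => t _; have /andP[p0 p1] := p01 t.
by case: (y t); rewrite ?subr_ge0.
Qed.

Lemma sum_outcome_prob p : \sum_y outcome_prob p y = 1.
Proof.
rewrite (sum_prod_outcomes (fun t z => if z then p t else 1 - p t)).
by apply: big1 => t _; rewrite addrC subrK.
Qed.

Definition flip_outcome t y : {ffun 'I_m -> bool} :=
  [ffun s => if s == t then ~~ y s else y s].

Lemma flip_outcomeE t y s :
  flip_outcome t y s = if s == t then ~~ y s else y s.
Proof. by rewrite ffunE. Qed.

Lemma flip_outcomeK t : involutive (flip_outcome t).
Proof.
by move=> y; apply/ffunP => s; rewrite !flip_outcomeE; case: eqP => //; rewrite negbK.
Qed.

Lemma sum_flip_outcome t (F : {ffun 'I_m -> bool} -> R) :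
  \sum_y F y = \sum_(y : {ffun 'I_m -> bool} | y t) (F y + F (flip_outcome t y)).
Proof.
rewrite (bigID (fun y : {ffun 'I_m -> bool} => y t)) big_split/=; congr (_ + _).
(* Flipping round [t] is an involution matching the outcomes with [y t] false to those with [y t]
   true. *)
rewrite (reindex_inj (inv_inj (flip_outcomeK t))).
by apply: eq_bigl => y; rewrite flip_outcomeE eqxx negbK.
Qed.

Definition outcome_prob_except t p y : R :=
  \prod_(s < m | s != t) (if y s then p s else 1 - p s).

Lemma outcome_probE t p y : outcome_prob p y =
  (if y t then p t else 1 - p t) * outcome_prob_except t p y.
Proof. by rewrite /outcome_prob (bigD1 t). Qed.

Lemma outcome_prob_except_flip t p y :
  outcome_prob_except t p (flip_outcome t y) = outcome_prob_except t p y.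
Proof.
by apply: eq_bigr => s st; rewrite flip_outcomeE (negbTE st).
Qed.

Definition score_except t q y : R := \sum_(s < m | s != t) qscore (q s) (y s).

Lemma total_scoreE t q y :
  total_score q y = qscore (q t) (y t) + score_except t q y.
Proof. by rewrite /total_score (bigD1 t). Qed.

Lemma score_except_flip t q y :
  score_except t q (flip_outcome t y) = score_except t q y.
Proof.
by apply: eq_bigr => s st; rewrite flip_outcomeE (negbTE st).
Qed.

Lemma total_score_flip t q y : in01 (q t) -> y t ->
  `|total_score q y - total_score q (flip_outcome t y)| <= 1.
Proof.
move=> /andP[q0 q1] yt; rewrite !(total_scoreE t) score_except_flip.
rewrite flip_outcomeE eqxx yt opprD addrACA subrr addr0 /qscore/=.
have -> : 1 - (1 - q t) ^+ 2 - (1 - (0 - q t) ^+ 2) = 2 * q t - 1 by ring.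
by rewrite ler_norml; apply/andP; split; lra.
Qed.

(** Choosing a likelier outcome in every other round gives factors of at least 1/2. A strict gain on
    one pair of positive weight is what makes the total gain strict, even when some beliefs are 0 or
    1. *)
Lemma outcome_prob_except_gt0 t p : (forall s, in01 (p s)) ->
  exists2 y : {ffun 'I_m -> bool}, y t & 0 < outcome_prob_except t p y.
Proof.
move=> p01; exists [ffun s => (s == t) || (1 / 2 < p s)].
  by rewrite ffunE eqxx.
apply: prodr_gt0 => s st; rewrite ffunE (negbTE st)/=.
have /andP[p0 p1] := p01 s.
by case: (ltP (1 / 2) (p s)) => h; lra.
Qed.

End Outcomes.

(** * The selected index and its best rival *)

Section Selection.
Variables (R : realType) (n : nat).
Implicit Types (u v w : 'I_n -> R) (i k : 'I_n).

Lemma measurable_forall (I : finType) d (T : measurableType d)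
    (E : I -> T -> bool) : (forall a, measurable_fun setT (E a)) ->
  measurable_fun setT (fun t => [forall a, E a t]).
Proof.
move=> mE.
have -> : (fun t => [forall a, E a t]) = (fun t => all (E^~ t) (enum I)).
  apply/funext => t; apply/forallP/allP => [Et a _|Et a]; first exact: Et.
  by apply: Et; rewrite mem_enum.
elim: (enum I) => [|a s ih] /=; first exact: measurable_cst.
exact: measurable_and.
Qed.

Lemma measurable_selected d (T : measurableType d) (v : T -> 'I_n -> R) i :
  (forall k, measurable_fun setT (fun t => v t k)) ->
  measurable_fun setT (fun t => selected (v t) i).
Proof.
move=> mv; apply: measurable_and; apply: measurable_forall => k.
  exact: measurable_fun_ler.
case: (k < i)%N => /=; last exact: measurable_cst.
exact: measurable_fun_ltr.
Qed.

Lemma coord_measurable_bool (E : ('I_n -> R) -> bool) :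
  (forall d (T : measurableType d) (W : T -> 'I_n -> R),
    (forall k, measurable_fun setT (fun t => W t k)) ->
    measurable_fun setT (fun t => E (W t))) ->
  coord_measurable (fun w => ((E w)%:R : R)%:E).
Proof.
move=> mE d T W mW; apply/measurable_EFinP.
have -> : (fun t => (E (W t))%:R : R) = (fun t => if E (W t) then 1 else 0).
  by apply/funext => t; case: (E _).
by apply: measurable_fun_ifT => //; exact: mE.
Qed.

Lemma coord_measurable_selected u i :
  coord_measurable (fun w => ((selected (fun k => u k + w k) i)%:R : R)%:E).
Proof.
apply: coord_measurable_bool => d T W mW; apply: measurable_selected => k.
exact: measurable_funD.
Qed.

Lemma selected_exists v : (0 < n)%N -> exists i, selected v i.
Proof.
move=> n0; pose i0 := Ordinal n0.
have [i _ imax'] := @arg_maxP _ R 'I_n i0 predT v isT.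
have imax k : v k <= v i by exact: imax'.
have [j jP jmin] := @arg_minnP 'I_n i (fun j => v j == v i) (@nat_of_ord n) (eqxx _).
exists j; apply/andP; split; apply/forallP => k; rewrite (eqP jP).
  exact: imax.
apply/implyP => kj; rewrite lt_neqAle imax andbT.
by apply: contraTN kj => /jmin; rewrite -leqNgt.
Qed.

(** [k0] is the seed that [arg max] asks for; once [k0 != i], the value is the true maximum over the
    rivals of [i]. *)
Definition best_rival i k0 v : R := v [arg max_(k > k0 | k != i) v k]%O.

Lemma best_rivalP i k0 v : k0 != i ->
  (forall k, k != i -> v k <= best_rival i k0 v) /\
  exists2 k, k != i & best_rival i k0 v = v k.
Proof.
move=> k0i; rewrite /best_rival; case: arg_maxP => // j ji jmax.
by split => //; exists j.
Qed.

(** A maximum is 1-Lipschitz for the sup norm, and the common noise [w] cancels. *)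
Lemma best_rival_dist i k0 u v w : k0 != i ->
  (forall k, k != i -> `|u k - v k| <= 1) ->
  `|best_rival i k0 (fun k => u k + w k) - best_rival i k0 (fun k => v k + w k)| <= 1.
Proof.
move=> k0i uv.
have [umax [ku kui uE]] := best_rivalP (fun k => u k + w k) k0i.
have [vmax [kv kvi vE]] := best_rivalP (fun k => v k + w k) k0i.
have := umax kv kvi; have := vmax ku kui.
have /ler_normlP[] := uv ku kui; have /ler_normlP[] := uv kv kvi.
rewrite /= in uE vE *; rewrite uE vE => *.
by apply/ler_normlP; split; lra.
Qed.

(** Once the other noises are fixed, [i] wins when its noise is above the best rival's lead and
    loses when it is below; only the tie is undetermined. *)
Lemma noise_int_selected b i k0 u w : 0 < b -> k0 != i ->
  noise_int b [:: i]
    (fun w' => ((selected (fun k => u k + w' k) i)%:R : R)%:E) w =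
  (laplace_tail b (best_rival i k0 (fun k => u k + w k) - u i))%:E.
Proof.
move=> b0 k0i /=; set c := best_rival _ _ _.
have [cmax [k ki cE]] := best_rivalP (fun k => u k + w k) k0i.
rewrite -/c in cmax cE.
pose V x k := u k + upd_noise w i x k.
have Vi x : V x i = u i + x by rewrite /V /upd_noise eqxx.
have Vk x j : j != i -> V x j = u j + w j.
  by move=> ji; rewrite /V /upd_noise (negbTE ji).
apply: (@integral_laplace_tail _ _ b0 (fun x => selected (V x) i)).
- apply: measurable_selected => j; apply: measurable_funD => //.
  exact: (measurable_upd_noise (W := fun _ => w)).
- move=> x; rewrite ltrBlDl => cx; apply/andP; split; apply/forallP => j; rewrite Vi.
    have [->|ji] := eqVneq j i; first by rewrite Vi.
    by rewrite Vk// (le_trans (cmax _ ji))// ltW.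
  apply/implyP => ji; have {}ji : j != i by rewrite neq_ltn ji.
  by rewrite Vk// (le_lt_trans (cmax _ ji)).
- move=> x /andP[/forallP/(_ k) + _]; rewrite Vi Vk// -cE.
  by rewrite lerBlDl.
Qed.

End Selection.

(** * Undominated reports are close to the beliefs *)

Lemma best_rival_ext (R : realType) (n : nat) (i k0 : 'I_n) (v v' : 'I_n -> R) :
  k0 != i -> (forall k, k != i -> v k = v' k) ->
  best_rival i k0 v = best_rival i k0 v'.
Proof.
move=> k0i vv'.
have [vmax [k ki vE]] := best_rivalP v k0i.
have [v'max [k' ki' vE']] := best_rivalP v' k0i.
apply/eqP; rewrite eq_le vE {1}vv'// v'max//= -vE vE' -vv'//.
exact: vmax.
Qed.

Lemma M_selE (R : realType) (n m : nat) (b : R) (Rep : 'I_n -> 'I_m -> R)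
    (y : {ffun 'I_m -> bool}) i : M_sel b Rep y i =
  noise_int b (enum 'I_n)
    (fun w => ((selected (fun k => total_score (Rep k) y + w k) i)%:R : R)%:E)
    (fun _ => 0).
Proof.
apply: eq_noise_int => w; congr (_ %:R)%:E; congr nat_of_bool.
apply/existsP/idP => [[j /andP[/eqP -> //]]|sel].
by exists i; rewrite inE eqxx.
Qed.

Section Dominance.
Variables (R : realType) (n m : nat) (gamma : R).
Hypothesis gamma_gt0 : 0 < gamma.
Hypothesis gamma_le : gamma <= 1 / 14.
Let b := 4 / gamma.
Variables (i k0 : 'I_n).
Hypothesis k0i : k0 != i.
Implicit Types (Rep : 'I_n -> 'I_m -> R) (p q : 'I_m -> R) (w : 'I_n -> R).

Let b_gt0 : 0 < b. Proof. by rewrite divr_gt0. Qed.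

(** The list [s] of the other indices is chosen before [g], so that two reports can be compared
    under one and the same outer integral. *)
Lemma noise_int_innermost : exists s, forall (g : ('I_n -> R) -> \bar R) w,
  (forall v, 0 <= g v)%E -> coord_measurable g ->
  noise_int b (enum 'I_n) g w = noise_int b s (noise_int b [:: i] g) w.
Proof.
have := enum_uniq 'I_n; have := mem_enum 'I_n i.
case/splitPr => s1 s2; rewrite cat_uniq /= => /and3P[_ _ /andP[is2 _]].
exists (s1 ++ s2) => g w g0 mg.
rewrite !noise_int_cat; apply: eq_noise_int => v.
by rewrite noise_int_rot1// -cats1 noise_int_cat.
Qed.

(* The probability that forecaster [i] is selected, conditionally on the noise
   [w] of the others, when outcomes are drawn from [p]. *)
Definition cond_win Rep p w : R :=
  \sum_(y : {ffun 'I_m -> bool}) outcome_prob p y *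
    laplace_tail b (best_rival i k0 (fun k => total_score (Rep k) y + w k) -
                    total_score (Rep i) y).

Lemma cond_win_ge0 Rep p w : (forall t, in01 (p t)) -> 0 <= cond_win Rep p w.
Proof.
move=> p01; apply: sumr_ge0 => y _.
by rewrite mulr_ge0 ?outcome_prob_ge0 ?laplace_tail_ge0.
Qed.

Lemma cond_win_le1 Rep p w : (forall t, in01 (p t)) -> cond_win Rep p w <= 1.
Proof.
move=> p01; rewrite -(sum_outcome_prob p); apply: ler_sum => y _.
by rewrite ler_piMr ?outcome_prob_ge0 ?laplace_tail_le1.
Qed.

Lemma M_exp_cond_win : exists s, forall Rep p, (forall t, in01 (p t)) ->
  coord_measurable (fun w => (cond_win Rep p w)%:E) /\
  M_exp b Rep p i = noise_int b s (fun w => (cond_win Rep p w)%:E) (fun _ => 0).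
Proof.
have [s Hs] := noise_int_innermost; exists s => Rep p p01.
pose f (y : {ffun 'I_m -> bool}) (w : 'I_n -> R) :=
  ((selected (fun k => total_score (Rep k) y + w k) i)%:R : R)%:E.
have f0 y w : (0 <= f y w)%E by rewrite lee_fin.
have mf y : coord_measurable (f y) by exact: coord_measurable_selected.
have o0 y : (0 <= (outcome_prob p y)%:E)%E by rewrite lee_fin outcome_prob_ge0.
pose g w := (\sum_y (outcome_prob p y)%:E * f y w)%E.
have g0 w : (0 <= g w)%E by apply: sume_ge0 => y _; exact: mule_ge0.
have mof y : coord_measurable (fun w => (outcome_prob p y)%:E * f y w)%E.
  exact: coord_measurable_scale.
have of0 y w : (0 <= (outcome_prob p y)%:E * f y w)%E by exact: mule_ge0.
have mg : coord_measurable g by exact: coord_measurable_sum.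
have gE : noise_int b [:: i] g = (fun w => (cond_win Rep p w)%:E).
  apply/funext => w; rewrite noise_int_sum// /cond_win -sumEFin.
  apply: eq_bigr => y _; rewrite noise_int_scale//.
  by rewrite (noise_int_selected _ _ b_gt0 k0i) -EFinM.
rewrite -gE; split; first exact: coord_measurable_noise_int.
rewrite -Hs// /M_exp noise_int_sum//; apply: eq_bigr => y _.
by rewrite noise_int_scale// M_selE.
Qed.

Lemma M_exp_lt Rep Rep' p : (forall t, in01 (p t)) ->
  (forall w, cond_win Rep p w < cond_win Rep' p w) ->
  (M_exp b Rep p i < M_exp b Rep' p i)%E.
Proof.
move=> p01 lt; have [s Hs] := M_exp_cond_win.
have [m1 ->] := Hs Rep _ p01; have [m2 ->] := Hs Rep' _ p01.
apply: lt_noise_int => // w; rewrite ?lee_fin ?lte_fin//.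
- exact: cond_win_ge0.
- exact: cond_win_le1.
Qed.

(** Outcomes are paired along round [t]. Within a pair everything but round [t] is fixed, so the
    pair contributes a one-round [win_payoff], with the score of the other rounds moved into the
    thresholds. *)
Lemma cond_winE Rep p q t w :
  let C y := best_rival i k0 (fun k => total_score (Rep k) y + w k) in
  cond_win (upd_row Rep i q) p w =
  \sum_(y : {ffun 'I_m -> bool} | y t) outcome_prob_except t p y *
    win_payoff gamma (p t) (C y - score_except t q y)
      (C (flip_outcome t y) - score_except t q y) (q t).
Proof.
move=> C; rewrite /cond_win (sum_flip_outcome t); apply: eq_bigr => y yt.
have rivalE y' : best_rival i k0
    (fun k => total_score (upd_row Rep i q k) y' + w k) = C y'.
  by apply: best_rival_ext => // k ki; rewrite /upd_row (negbTE ki).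
have ui : upd_row Rep i q i = q by rewrite /upd_row eqxx.
rewrite !rivalE ui !(outcome_probE t) !(total_scoreE t).
rewrite outcome_prob_except_flip score_except_flip flip_outcomeE eqxx yt/=.
rewrite /win_payoff -/b.
rewrite !opprD !addrA !(addrAC _ (- score_except t q y)).
by ring.
Qed.

Lemma truthful_coordinate_dominates p r t :
  (forall s, in01 (p s)) -> in01 (r t) -> gamma < `|r t - p t| ->
  strictly_dominates b i p (fun s => if s == t then p s else r s) r.
Proof.
move=> p01 r01 gt Rep Rep01; set rhat := fun s => _.
apply: M_exp_lt => // w; rewrite !(cond_winE _ _ _ t).
pose C (y : {ffun 'I_m -> bool}) := best_rival i k0 (fun k => total_score (Rep k) y + w k).
have scoreE y : score_except t rhat y = score_except t r y.
  by apply: eq_bigr => s st; rewrite /rhat (negbTE st).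
have lt (y : {ffun 'I_m -> bool}) : y t -> win_payoff gamma (p t) (C y - score_except t r y)
      (C (flip_outcome t y) - score_except t r y) (r t) <
    win_payoff gamma (p t) (C y - score_except t r y)
      (C (flip_outcome t y) - score_except t r y) (p t).
  move=> yt; apply: win_payoff_lt => //.
  (* The score of the other rounds cancels between the two thresholds, and flipping one outcome
     moves each rival's total by at most 1. *)
  rewrite opprB addrA subrK; apply: best_rival_dist => // k _.
  exact: total_score_flip.
have rt : rhat t = p t by rewrite /rhat eqxx.
have o0 (y : {ffun 'I_m -> bool}) : 0 <= outcome_prob_except t p y.
  apply: prodr_ge0 => s _; have /andP[? ?] := p01 s.
  by case: (y s); rewrite ?subr_ge0.
have [y0 y0t o_gt0] := outcome_prob_except_gt0 t p01.
rewrite (bigD1 y0)//= [ltRHS](bigD1 y0)//= !scoreE rt; apply: ltr_leD.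
  by rewrite ltr_pM2l// lt.
apply: ler_sum => y /andP[yt _]; rewrite scoreE ler_wpM2l//.
by apply/ltW/lt.
Qed.

Lemma undominated_close p r t : (forall s, in01 (p s)) ->
  (forall s, in01 (r s)) -> undominated b i p r -> `|r t - p t| <= gamma.
Proof.
move=> p01 r01 und; rewrite leNgt; apply/negP => gt; apply: und.
exists (fun s => if s == t then p s else r s); split.
  by move=> s; case: eqP.
exact: truthful_coordinate_dominates.
Qed.

End Dominance.

(** * Exponential moments *)

Section NoiseProduct.
Variables (R : realType) (n : nat) (b : R).
Hypothesis b_gt0 : 0 < b.
Let mu := @lebesgue_measure R.

(** Independence: each integration replaces one factor by its mean. Factors outside [s] are kept at
    [w] so that the induction goes through. *)
Lemma noise_int_prod (F : 'I_n -> R -> R) (c : 'I_n -> R) s w :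
  uniq s -> (forall l x, 0 <= F l x) -> (forall l, measurable_fun setT (F l)) ->
  (forall l, \int[mu]_x ((laplace_pdf b x)%:E * (F l x)%:E) = (c l)%:E)%E ->
  noise_int b s (fun v => (\prod_l F l (v l))%:E) w =
  (\prod_l (if l \in s then c l else F l (w l)))%:E.
Proof.
move=> + F0 mF cE; elim: s w => [|l s ih] w //= /andP[ls us].
pose P := \prod_(k < n | k != l) (if k \in l :: s then c k else F k (w k)).
have P0 : 0 <= P.
  apply: prodr_ge0 => k _; case: ifP => // _.
  rewrite -lee_fin -cE; apply: integral_ge0 => x _.
  by rewrite mule_ge0// lee_fin// laplace_pdf_ge0.
transitivity (\int[mu]_x (P%:E * ((laplace_pdf b x)%:E * (F l x)%:E)))%E.
  apply: eq_integral => x _; rewrite ih//.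
  rewrite (bigD1 l)//= (negbTE ls) /upd_noise eqxx muleCA; congr (_ * _)%E.
  rewrite EFinM muleC; congr (_%:E * _)%E; apply: eq_bigr => k kl.
  by rewrite inE (negbTE kl).
rewrite ge0_integralZl//.
- by rewrite cE [in RHS](bigD1 l)//= inE eqxx/= EFinM muleC.
- apply: emeasurable_funM; apply/measurable_EFinP; last exact: mF.
  exact: measurable_laplace_pdf.
- by move=> x _; rewrite mule_ge0// lee_fin// laplace_pdf_ge0.
Qed.

(** Tilting the density by [expR (|x| / (2 * b))] gives twice the Laplace density of scale
    [2 * b]. *)
Lemma integral_laplace_pdf_expR :
  (\int[mu]_x ((laplace_pdf b x)%:E * (expR (`|x| / (2 * b)))%:E) = 2%:E)%E.
Proof.
have b2 : 0 < 2 * b by rewrite mulr_gt0.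
transitivity (\int[mu]_x (2%:E * (laplace_pdf (2 * b) x)%:E))%E.
  apply: eq_integral => x _; rewrite -!EFinM; congr EFin.
  rewrite /laplace_pdf -mulrA -expRD.
  have -> : - (`|x| / b) + `|x| / (2 * b) = - (`|x| / (2 * b)).
    by field; rewrite gt_eqF.
  by field; rewrite gt_eqF.
rewrite ge0_integralZl//.
- by rewrite integral_laplace_pdf// mule1.
- by apply/measurable_EFinP; exact: measurable_laplace_pdf.
- by move=> x _; rewrite lee_fin laplace_pdf_ge0.
Qed.

(** A Chernoff bound: selecting [j] forces [u k + v k <= u j + v j], so the indicator is at most the
    exponential of the difference over [2 * b]. The noises of [j] and [k] contribute a mean of at
    most 2 each, whence the 4. *)
Lemma noise_int_selected_le j k (u : 'I_n -> R) w : j != k ->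
  (noise_int b (enum 'I_n)
     (fun v => ((selected (fun i => u i + v i) j)%:R : R)%:E) w <=
   (4 * expR ((u j - u k) / (2 * b)))%:E)%E.
Proof.
move=> jk; pose F (l : 'I_n) (x : R) : R :=
  if (l == j) || (l == k) then expR (`|x| / (2 * b)) else 1.
have b2 : 0 < 2 * b by rewrite mulr_gt0.
have F1 l x : 1 <= F l x.
  rewrite /F; case: ifP => // _; apply: le_trans (expR_ge1Dx _).
  by rewrite lerDl divr_ge0// ltW.
have F0 l x : 0 <= F l x by exact: le_trans (F1 l x).
have mF l : measurable_fun setT (F l).
  rewrite /F; case: (_ || _) => //; apply: continuous_measurable_fun => x.
  apply: continuous_comp; last exact: continuous_expR.
  apply: cvgM; last exact: cvg_cst.
  exact: norm_continuous.
pose c (l : 'I_n) : R := if (l == j) || (l == k) then 2 else 1.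
have cE l : (\int[mu]_x ((laplace_pdf b x)%:E * (F l x)%:E) = (c l)%:E)%E.
  rewrite /F /c; case: (_ || _); first exact: integral_laplace_pdf_expR.
  by under eq_integral do rewrite mule1; rewrite integral_laplace_pdf.
pose K := expR ((u j - u k) / (2 * b)).
have K0 : 0 <= K by exact: expR_ge0.
have mprod : coord_measurable (fun v => (\prod_l F l (v l))%:E).
  move=> d T W mW; apply/measurable_EFinP.
  elim: (index_enum 'I_n) => [|l s ih].
    by under eq_fun do rewrite big_nil; exact: measurable_cst.
  under eq_fun do rewrite big_cons.
  by apply: measurable_funM => //; apply: measurableT_comp.
have -> : (4 * K)%:E = noise_int b (enum 'I_n)
    (fun v => K%:E * (\prod_l F l (v l))%:E)%E w.
  rewrite noise_int_scale ?lee_fin//; last first.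
    by move=> v; rewrite lee_fin prodr_ge0.
  rewrite (@noise_int_prod F c)// ?enum_uniq// -EFinM mulrC; congr (_ * _)%:E.
  rewrite (bigD1 j)//= (bigD1 k) ?[k == j]eq_sym//= big1; last first.
    by move=> l /andP[lj lk]; rewrite mem_enum/= /c (negbTE lj) (negbTE lk).
  by rewrite !mem_enum /c !eqxx orbT/= mulr1 -natrM.
apply: le_noise_int => //.
- exact: coord_measurable_selected.
- exact: coord_measurable_scale.
move=> v; rewrite -EFinM lee_fin.
have prod0 : 0 <= \prod_l F l (v l) by apply: prodr_ge0.
case: (boolP (selected _ _)) => [|_]; last by rewrite mulr_ge0.
move=> /andP[/forallP/(_ k) kj _].
have Fprod : expR ((v j - v k) / (2 * b)) <= \prod_l F l (v l).
  rewrite (bigD1 j)//= (bigD1 k) ?[k == j]eq_sym//=.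
  rewrite {1 2}/F !eqxx orbT/= mulrA -expRD.
  rewrite -[leLHS]mulr1 ler_pM ?expR_ge0//.
    rewrite ler_expR -mulrDl ler_pM2r ?invr_gt0//.
    by rewrite (le_trans (ler_norm _))// ler_normB.
  by elim/big_ind: _ => // x y x1 y1; exact: mulr_ege1.
apply: le_trans (ler_wpM2l K0 Fprod).
rewrite /K -expRD -mulrDl; apply: le_trans (expR_ge1Dx _).
rewrite /= lerDl divr_ge0 ?(ltW b2)//.
by rewrite addrACA -opprD subr_ge0.
Qed.

End NoiseProduct.

(** * Moment generating function of score differences *)

Section Concentration.
Variables (R : realType).

(** Multiplying the right side by [1 - x] gives [1 + x ^+ 2 * (1 - 2 * x)], which is at least 1. *)
Lemma expR_le_quadratic (x : R) : x <= 1 / 2 -> expR x <= 1 + x + 2 * x ^+ 2.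
Proof.
move=> x2; have x1 : x < 1 by lra.
apply: le_trans (expR_le_invB x1) _.
rewrite -[leLHS]mul1r ler_pdivrMr ?subr_gt0//.
have h := mulr_ge0 (sqr_ge0 x) (_ : 0 <= 1 - 2 * x).
by rewrite -subr_ge0; move: h => /(_ ltac:(lra)); lra.
Qed.

(** Both exponentials are bounded quadratically and averaged; [1 + u <= expR u] then turns the
    result back into an exponential. *)
Lemma bernoulli_mgf (lam th d1 d0 : R) : 0 <= lam <= 1 / 2 -> in01 th ->
  `|d1| <= 1 -> `|d0| <= 1 ->
  th * expR (- lam * d1) + (1 - th) * expR (- lam * d0) <=
  expR (- lam * (th * d1 + (1 - th) * d0) + 2 * lam ^+ 2).
Proof.
move=> /andP[lam0 lam1] /andP[th0 th1] d11 d01.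
have quad d : `|d| <= 1 -> expR (- lam * d) <= 1 - lam * d + 2 * lam ^+ 2.
  move=> hd; have lamd : - lam * d <= 1 / 2.
    rewrite mulNr -mulrN (le_trans (ler_norm _))// normrM normrN ger0_norm//.
    by rewrite (le_trans _ lam1)// ler_piMr.
  apply: le_trans (expR_le_quadratic lamd) _.
  rewrite mulNr lerD2l sqrrN exprMn ler_pM2l// ler_piMr ?sqr_ge0//.
  by rewrite -real_normK ?num_real// expr_le1.
have q1 := ler_wpM2l th0 (quad _ d11).
have th0' : 0 <= 1 - th by lra.
have q0 := ler_wpM2l th0' (quad _ d01).
apply: le_trans (expR_ge1Dx _).
apply: le_trans (lerD q1 q0) _.
by rewrite le_eqVlt; apply/orP; left; apply/eqP; ring.
Qed.

Lemma expectation_expR_le (m : nat) (lam : R) (th : 'I_m -> R)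
    (d : 'I_m -> bool -> R) : 0 <= lam <= 1 / 2 -> (forall t, in01 (th t)) ->
  (forall t z, `|d t z| <= 1) ->
  \sum_(y : {ffun 'I_m -> bool})
     outcome_prob th y * expR (- lam * \sum_(t < m) d t (y t)) <=
  expR (- lam * (\sum_(t < m) (th t * d t true + (1 - th t) * d t false)) +
    m%:R * (2 * lam ^+ 2)).
Proof.
move=> hlam th01 d1.
pose F (t : 'I_m) (z : bool) :=
  (if z then th t else 1 - th t) * expR (- lam * d t z).
rewrite (eq_bigr (fun y : {ffun 'I_m -> bool} => \prod_(t < m) F t (y t))); last first.
  by move=> y _; rewrite mulr_sumr expR_sum big_split.
rewrite sum_prod_outcomes.
have -> : m%:R * (2 * lam ^+ 2) = \sum_(t < m) (2 * lam ^+ 2).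
  by rewrite sumr_const card_ord mulr_natl.
rewrite mulr_sumr -big_split/= expR_sum; apply: ler_prod => t _.
rewrite /F; apply/andP; split; last exact: bernoulli_mgf.
have /andP[? ?] := th01 t.
by rewrite addr_ge0// mulr_ge0 ?expR_ge0// subr_ge0.
Qed.

Lemma qscore_in01 (q : R) z : in01 q -> 0 <= qscore q z <= 1.
Proof.
move=> /andP[q0 q1]; rewrite /qscore; apply/andP; split; last first.
  by rewrite lerBlDr lerDl sqr_ge0.
by rewrite subr_ge0 -real_normK ?num_real// expr_le1// ler_norml; case: z => /=;
  apply/andP; split; lra.
Qed.

Lemma qscore_dist (q q' : R) z : in01 q -> in01 q' ->
  `|qscore q z - qscore q' z| <= 1.
Proof.
move=> /(qscore_in01 z)/andP[? ?] /(qscore_in01 z)/andP[? ?].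
by rewrite ler_norml; apply/andP; split; lra.
Qed.

(** Properness of the quadratic score: the mean score of [q] is a constant minus [(q - th) ^+ 2]. *)
Lemma mean_qscoreB (th q q' : R) :
  th * (qscore q true - qscore q' true) +
  (1 - th) * (qscore q false - qscore q' false) =
  (q' - th) ^+ 2 - (q - th) ^+ 2.
Proof. by rewrite /qscore/=; ring. Qed.

Lemma sqr_dist_close (g r p th : R) : in01 r -> in01 p -> in01 th ->
  `|r - p| <= g -> `|(r - th) ^+ 2 - (p - th) ^+ 2| <= 2 * g.
Proof.
move=> /andP[r0 r1] /andP[p0 p1] /andP[t0 t1] rp.
have -> : (r - th) ^+ 2 - (p - th) ^+ 2 = (r + p - 2 * th) * (r - p) by ring.
rewrite normrM ler_pM// ler_norml; apply/andP; split; lra.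
Qed.

End Concentration.

(** * Selection of an accurate forecaster *)

Section Mechanism.
Variables (R : realType) (n m : nat) (b : R).
Hypothesis b_gt0 : 0 < b.
Implicit Types (Rep P : 'I_n -> 'I_m -> R) (y : {ffun 'I_m -> bool}).

Lemma coord_measurable_exists_selected (u : 'I_n -> R) (A : pred 'I_n) :
  coord_measurable (fun w =>
    (([exists i, (i \in A) && selected (fun j => u j + w j) i])%:R : R)%:E).
Proof.
apply: coord_measurable_bool => d T W mW.
have -> : (fun t => [exists i, (i \in A) && selected (fun j => u j + W t j) i]) =
    (fun t => ~~ [forall i, ~~ ((i \in A) && selected (fun j => u j + W t j) i)]).
  by apply/funext => t; rewrite -negb_exists negbK.
apply/measurable_neg/measurable_forall => i; apply: measurable_neg.
case: (i \in A) => /=; last exact: measurable_cst.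
by apply: measurable_selected => k; exact: measurable_funD.
Qed.

Lemma rnm_prob_ge0 Rep y (A : pred 'I_n) : (0 <= rnm_prob b Rep y A)%E.
Proof. by apply: noise_int_ge0 => // w; rewrite lee_fin. Qed.

(** Some forecaster is always selected, either in [A] or outside it; the union bound needs only this
    inequality. *)
Lemma rnm_prob_compl Rep y (A : pred 'I_n) : (0 < n)%N ->
  (1 <= rnm_prob b Rep y A + \sum_(j | j \notin A) M_sel b Rep y j)%E.
Proof.
move=> n0; pose u j := total_score (Rep j) y.
pose f i w : \bar R := ((selected (fun j => u j + w j) i)%:R : R)%:E.
pose g w : \bar R :=
  (([exists i, (i \in A) && selected (fun j => u j + w j) i])%:R : R)%:E.
have f0 i w : (0 <= f i w)%E by rewrite lee_fin.
have g0 w : (0 <= g w)%E by rewrite lee_fin.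
have mf i : coord_measurable (f i) by exact: coord_measurable_selected.
have mg : coord_measurable g by exact: coord_measurable_exists_selected.
have ms : coord_measurable (fun w => \sum_(j | j \notin A) f j w)%E.
  exact: coord_measurable_sum.
rewrite /rnm_prob /noise_prob -/g.
under eq_bigr do rewrite M_selE.
rewrite -(noise_int_sum b_gt0 (enum 'I_n) _ _ (g := f))// -noise_int_add//; last first.
  by move=> w; exact: sume_ge0.
rewrite -[leLHS](noise_int_cst b_gt0 (enum 'I_n) (fun _ => 0))//.
apply: le_noise_int => //; first exact: coord_measurable_add.
move=> w; have [i seli] := selected_exists (fun j => u j + w j) n0.
have sum0 : (0 <= \sum_(j | j \notin A) f j w)%E by exact: sume_ge0.
case: (boolP (i \in A)) => iA.
  have -> : g w = 1%E.
    by rewrite /g; have -> : [exists i, (i \in A) && selected (fun j => u j + w j) i]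
      by apply/existsP; exists i; rewrite iA.
  by rewrite leeDl.
rewrite (bigD1 i)//= addeCA -[leLHS]adde0 leeD//.
  by rewrite /f seli.
by rewrite adde_ge0// sume_ge0.
Qed.

Lemma M_sel_le Rep y j k : j != k ->
  (M_sel b Rep y j <=
   (4 * expR ((total_score (Rep j) y - total_score (Rep k) y) / (2 * b)))%:E)%E.
Proof. by move=> jk; rewrite M_selE; exact: noise_int_selected_le. Qed.

Lemma expected_M_sel_le Rep (theta : 'I_m -> R) j k : 1 <= b -> j != k ->
  (forall i t, in01 (Rep i t)) -> (forall t, in01 (theta t)) ->
  (\sum_(y : {ffun 'I_m -> bool}) (outcome_prob theta y)%:E * M_sel b Rep y j <=
   (4 * expR (- (2 * b)^-1 * (\sum_t (Rep j t - theta t) ^+ 2 -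
      \sum_t (Rep k t - theta t) ^+ 2) + m%:R * (2 * (2 * b)^-1 ^+ 2)))%:E)%E.
Proof.
move=> b1 jk Rep01 th01.
pose d t z := qscore (Rep k t) z - qscore (Rep j t) z.
have lam : 0 <= (2 * b)^-1 <= 1 / 2.
  rewrite invr_ge0 mulr_ge0 ?(ltW b_gt0)//= div1r lef_pV2 ?posrE ?mulr_gt0//.
  by rewrite ler_pMr.
have d1 t z : `|d t z| <= 1 by exact: qscore_dist.
have := expectation_expR_le lam th01 d1.
have -> : \sum_t (theta t * d t true + (1 - theta t) * d t false) =
    \sum_t (Rep j t - theta t) ^+ 2 - \sum_t (Rep k t - theta t) ^+ 2.
  by rewrite -sumrB; apply: eq_bigr => t _; rewrite mean_qscoreB.
move=> le4; rewrite -lee_fin in le4.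
apply: le_trans (_ : _ <= 4%:E * (\sum_(y : {ffun 'I_m -> bool})
     outcome_prob theta y * expR (- (2 * b)^-1 * \sum_(t < m) d t (y t)))%:E)%E _.
  rewrite -sumEFin ge0_sume_distrr; last first.
    by move=> y _; rewrite lee_fin mulr_ge0 ?expR_ge0 ?outcome_prob_ge0.
  apply: lee_sum => y _; rewrite -EFinM mulrCA EFinM.
  apply: lee_wpmul2l; first by rewrite lee_fin outcome_prob_ge0.
  apply: le_trans (M_sel_le _ _ jk) _.
  rewrite lee_fin ler_pM2l// ler_expR /d sumrB mulNr mulrC -mulrN opprB.
  by rewrite /total_score.
by rewrite [leRHS]EFinM lee_pmul2l// lte_fin.
Qed.

End Mechanism.

(** * Accuracy gap, choice of constants and union bound *)

Lemma sum_sqr_dist_gap (R : realType) (n m : nat) (eps : R) (theta : 'I_m -> R)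
    (P : 'I_n -> 'I_m -> R) j : (0 < m)%N -> ~~ eps_optimal eps theta P j ->
  exists k, m%:R * eps < \sum_t (P j t - theta t) ^+ 2 - \sum_t (P k t - theta t) ^+ 2.
Proof.
move=> m0; rewrite negb_forall => /existsP[k]; rewrite -ltNge /accuracy => lt.
have mR : 0 < m%:R :> R by rewrite ltr0n.
exists k; rewrite -ltr_pdivlMl// mulrBr.
by lra.
Qed.

(** Here the rate is [gamma / 8]. With [gamma <= eps / 14], [D] is at least [10/14 * m * eps] and
    the quadratic term is at most [m * gamma * eps / 448], so the exponent is at most
    [- 39/448 * m * gamma * eps]; the hypothesis [28 * L <= m * eps * gamma] already gives [- 2 * L]
    from 32 of these 39 parts. *)
Lemma bad_selection_exponent (R : realType) (m : nat) (eps gamma L D : R) :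
  0 < gamma -> gamma <= eps / 14 -> 28 * L / (eps * gamma) <= m%:R ->
  m%:R * eps - 4 * gamma * m%:R <= D ->
  - (2 * (4 / gamma))^-1 * D + m%:R * (2 * (2 * (4 / gamma))^-1 ^+ 2) <= - 2 * L.
Proof.
move=> g0 ge mL hD; have e0 : 0 < eps by lra.
have -> : (2 * (4 / gamma))^-1 = gamma / 8 by field; rewrite gt_eqF.
rewrite ler_pdivrMr ?mulr_gt0// in mL.
have m0 : 0 <= m%:R :> R by [].
have h1 : gamma * (m%:R * eps - 4 * gamma * m%:R) <= gamma * D by rewrite ler_pM2l.
have h2 : m%:R * gamma * gamma <= m%:R * gamma * (eps / 14).
  by rewrite ler_wpM2l// mulr_ge0// ltW.
have h3 : 0 <= m%:R * gamma * eps by rewrite !mulr_ge0// ltW.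
lra.
Qed.

Lemma sum_sqr_dist_close (R : realType) (m : nat) (g : R) (r p th : 'I_m -> R) :
  (forall t, in01 (r t)) -> (forall t, in01 (p t)) -> (forall t, in01 (th t)) ->
  (forall t, `|r t - p t| <= g) ->
  `|\sum_t (r t - th t) ^+ 2 - \sum_t (p t - th t) ^+ 2| <= 2 * g * m%:R.
Proof.
move=> r01 p01 th01 rp; rewrite -sumrB (le_trans (ler_norm_sum _ _ _))//.
apply: le_trans (ler_sum _ (fun t _ => sqr_dist_close (r01 t) (p01 t) (th01 t) (rp t))) _.
by rewrite sumr_const card_ord mulr_natr.
Qed.

Theorem mainTheorem17 (R : realType) (n m : nat) (eps delta gamma : R)
  (P Rep : 'I_n -> 'I_m -> R) (theta : 'I_m -> R) :
  (0 < n)%N ->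
  0 < eps <= 1 ->
  0 < delta < 1 ->
  0 < gamma <= eps / 14 ->
  (forall i t, in01 (P i t)) ->
  (forall t, in01 (theta t)) ->
  28 * ln (2 * n%:R / delta) / (eps * gamma) <= m%:R ->
  (forall i t, in01 (Rep i t)) ->
  (forall i, undominated (4 / gamma) i (P i) (Rep i)) ->
  ((1 - delta)%:E <=
     \sum_(y : {ffun 'I_m -> bool})
        (outcome_prob theta y)%:E * rnm_prob (4 / gamma) Rep y (eps_optimal eps theta P))%E.
Proof.
move=> n0 /andP[e0 e1] /andP[d0 d1] /andP[g0 ge] P01 th01 mL Rep01 und.
set b := 4 / gamma; set A := eps_optimal eps theta P.
have b0 : 0 < b by rewrite divr_gt0.
have g14 : gamma <= 1 / 14 by lra.
have b1 : 1 <= b by rewrite ler_pdivlMr// mul1r; lra.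
have nR : 1 <= n%:R :> R by rewrite ler1n.
set L := ln _ in mL.
have x1 : 1 < 2 * n%:R / delta by rewrite ltr_pdivlMr//; lra.
have x0 : 0 < 2 * n%:R / delta by exact: lt_trans x1.
have L0 : 0 < L by rewrite ln_gt0.
have m0 : (0 < m)%N.
  rewrite -(ltr0n R); apply: lt_le_trans mL.
  by rewrite divr_gt0 ?mulr_gt0.
(* A rival [k] is required: a lone forecaster is always selected, so none of its reports is
   dominated. *)
have close i k t : k != i -> `|Rep i t - P i t| <= gamma.
  by move=> ki; apply: (undominated_close g0 g14 ki).
have o0 y : (0 <= (outcome_prob theta y)%:E)%E.
  by rewrite lee_fin outcome_prob_ge0.
have M0 y j : (0 <= M_sel b Rep y j)%E by exact: rnm_prob_ge0.
have bad j : j \notin A -> (\sum_(y : {ffun 'I_m -> bool})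
    (outcome_prob theta y)%:E * M_sel b Rep y j <= (delta / n%:R)%:E)%E.
  move=> jA; have [k gap] := sum_sqr_dist_gap m0 jA.
  have jk : j != k.
    apply: contraTneq gap => ->; rewrite subrr -leNgt.
    by rewrite mulr_ge0// ltW.
  apply: (le_trans (expected_M_sel_le b0 b1 jk Rep01 th01)).
  set D := \sum_t _ - _.
  (* Passing from beliefs to reports costs [2 * gamma * m] for each of [j] and [k]. *)
  have hD : m%:R * eps - 4 * gamma * m%:R <= D.
    have kj : k != j by rewrite eq_sym.
    have := sum_sqr_dist_close (Rep01 j) (P01 j) th01 (fun t => close j k t kj).
    have := sum_sqr_dist_close (Rep01 k) (P01 k) th01 (fun t => close k j t jk).
    rewrite !ler_norml /D => /andP[? ?] /andP[? ?]; lra.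
  have expo := bad_selection_exponent g0 ge mL hD.
  (* With [L = ln (2 * n / delta)], the 4 cancels the square of 2 and leaves [(delta / n) ^+ 2], at
     most [delta / n] because [delta / n <= 1]. *)
  rewrite lee_fin; apply: (@le_trans _ _ (4 * expR (- 2 * L))).
    by rewrite ler_pM2l// ler_expR.
  have -> : - 2 * L = - L + - L by ring.
  rewrite expRD expRN /L lnK ?posrE// invf_div.
  have -> : 4 * (delta / (2 * n%:R) * (delta / (2 * n%:R))) =
    (delta / n%:R) * (delta / n%:R) :> R.
    by field; rewrite gt_eqF// (lt_le_trans _ nR).
  have dn : 0 <= delta / n%:R by rewrite divr_ge0// ltW.
  rewrite ler_piMr// ler_pdivrMr ?(lt_le_trans _ nR)//.
  by rewrite mul1r (le_trans (ltW d1)).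
rewrite EFinB leeBlDr//.
set T := (\sum_y _)%E.
apply: (@le_trans _ _ (T + \sum_(j | j \notin A) \sum_(y : {ffun 'I_m -> bool})
    (outcome_prob theta y)%:E * M_sel b Rep y j)%E); last first.
  (* At most [n] forecasters are bad, each selected with probability at most [delta / n]. *)
  rewrite leeD2l//; apply: le_trans (lee_sum _ bad) _.
  rewrite sumEFin lee_fin sumr_const -(mulr_natr (delta / n%:R)).
  rewrite mulrAC ler_pdivrMr ?(lt_le_trans _ nR)// ler_pM2l// ler_nat.
  by rewrite -[leqRHS]card_ord max_card.
rewrite exchange_big/= /T -big_split/=.
rewrite -(sum_outcome_prob theta) -sumEFin; apply: lee_sum => y _.
rewrite -ge0_sume_distrr// -ge0_muleDr ?rnm_prob_ge0//; last exact: sume_ge0.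
rewrite -[leLHS]mule1 lee_wpmul2l//.
exact: rnm_prob_compl.
Qed.
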